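(* Let $X, Y$ be Banach spaces with $X$ reflexive, $\Omega\subseteq X$ an open set, $F:\Omega\to Y$ a continuously differentiable function and $C\subset Y$ a nonempty closed convex cone. Take $\tilde{x}\in\Omega$, $R>0$, $L>0$ and $b>0$. Suppose that $F$ satisfies Robinson's condition at $\tilde{x}$ (i.e. $\mathrm{rge}\,T_{\tilde{x}}=Y$), that $$B(\tilde{x},R)\subseteq\Omega,\qquad \|T_{\tilde{x}}^{-1}[F'(y)-F'(x)]\|\le L\|y-x\|\quad\forall x,y\in B(\tilde{x},R),$$ and that $2bL\le1$. Moreover, assume that $\|T_{\tilde{x}}^{-1}(-F(\tilde{x}))\|\le b$. Define $f:[0,+\infty)\to\mathbb{R}$ by $f(t):=Lt^2/2-t+b$. Then $f$ has $t_*:=(1-\sqrt{1-2bL})/L$ as its smallest zero, and the sequences generated by Newton's method for solving the inclusion $F(x)\in C$ and the equation $f(t)=0$, with starting points $x_0=\tilde{x}$ and $t_0=0$ respectively, $$x_{k+1}\in x_k+\mathrm{argmin}\{\|d\| : F(x_k)+F'(x_k)d\in C\},\qquad t_{k+1}=t_k-\frac{f(t_k)}{f'(t_k)},\qquad k=0,1,\ldots,$$ are well defined; $\{x_k\}$ is contained in $B(\tilde{x},t_* )$; $\{t_k\}$ is strictly increasing, is contained in $[0,t_* )$ and converges to $t_*$; and $$\|x_{k+1}-x_k\|\le t_{k+1}-t_k\quad(k=0,1,\ldots),\qquad\|x_{k+1}-x_k\|\le\frac{t_{k+1}-t_k}{(t_k-t_{k-1})^2}\|x_k-x_{k-1}\|^2\quad(k=1,2,\ldots).$$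 Moreover, $\{x_k\}$ converges to some $x_*\in B[\tilde{x},t_*]$ such that $F(x_* )\in C$, $$\|x_*-x_k\|\le t_*-t_k,\qquad t_*-t_{k+1}\le\tfrac12(t_*-t_k),\qquad k=0,1,\ldots,$$ and therefore $\{t_k\}$ converges $Q$-linearly to $t_*$ and $\{x_k\}$ converges $R$-linearly to $x_*$. Additionally, if $2bL<1$, then $$\|x_{k+1}-x_k\|\le\frac{L}{2\sqrt{1-2bL}}\|x_k-x_{k-1}\|^2,\qquad t_{k+1}-t_k\le\frac{L}{2\sqrt{1-2bL}}(t_k-t_{k-1})^2,\qquad k=1,2,\ldots,$$ and, as a consequence, $\{x_k\}$ and $\{t_k\}$ converge $Q$-quadratically to $x_*$ and $t_*$, respectively, as follows: $$\limsup_{k\to\infty}\frac{\|x_*-x_{k+1}\|}{\|x_*-x_k\|^2}\le\frac{L}{2\sqrt{1-2bL}},\qquad t_*-t_{k+1}\le\frac{L}{2\sqrt{1-2bL}}(t_*-t_k)^2,\quad k=0,1,\ldots.$$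
   Context: $B(x,\delta)$ and $B[x,\delta]$ are the open and closed balls with centre $x$ and radius $\delta$. For $z\in\Omega$, $T_z:X\rightrightarrows Y$ is the set-valued map $T_zd=F'(z)d-C$, and $T_z^{-1}:Y\rightrightarrows X$ is its inverse, $T_z^{-1}y=\{d\in X: F'(z)d-y\in C\}$. $\mathrm{rge}\,T_z=\bigcup_{d\in X}T_zd$. For a set-valued map $S$ between Banach spaces, $\mathrm{dom}\,S=\{d: Sd\ne\varnothing\}$, $\|Sd\|:=\inf\{\|v\|: v\in Sd\}$ (with $\|Sd\|=+\infty$ if $Sd=\varnothing$), and $\|S\|:=\sup\{\|Sd\|: d\in\mathrm{dom}\,S,\ \|d\|\le1\}$. For a linear map $A:X\to Y$, $T_z^{-1}A$ is the composition $d\mapsto T_z^{-1}(Ad)$. The sequence $\{x_k\}$ is any sequence obtained by choosing at each step an element of the (possibly multi-element) argmin set.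
   Formalization: The formal statement additionally assumes t_* ≤ R and B[x̃,t_*] ⊆ Ω (both hold if t_* < R); without them the iterates or the limit x_* can leave Ω and the claim fails, e.g. F(x)=x−1 on Ω=(−0.1,0.1), C={0}, x̃=0, R=0.1, b=1, L=1/2. *)

(* Defs.v *)
From mathcomp Require Import all_boot all_order all_algebra.
From mathcomp Require Import all_classical all_reals all_analysis.

Set Implicit Arguments.
Unset Strict Implicit.
Unset Printing Implicit Defensive.
Import Order.TTheory GRing.Theory Num.Theory.
Import numFieldNormedType.Exports.
Local Open Scope classical_set_scope.
Local Open Scope ring_scope.

Section banach_spaces.
Context {R : realType}.

(* Extended-real valued, so that it is meaningful without a boundedness
   proof; it is finite exactly on the bounded linear maps. *)
Definition opnorm {V W : normedModType R} (A : V -> W) : \bar R :=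
  ereal_sup [set `|A v|%:E | v in [set v : V | `|v| <= 1]].

Definition continuous_dual (V : normedModType R) : set (V -> R^o) :=
  [set phi | linear phi /\ continuous phi].

(* Elements of the bidual are represented by functionals on all functions
   V -> R of which only the values on [continuous_dual V] matter. *)
Definition continuous_bidual (V : normedModType R) : set ((V -> R^o) -> R^o) :=
  [set Psi : (V -> R^o) -> R^o |
    (forall a phi psi, continuous_dual phi -> continuous_dual psi ->
       Psi (a *: phi + psi) = a * Psi phi + Psi psi) /\
    (exists M : R, forall phi, continuous_dual phi ->
       (`|Psi phi|%:E <= M%:E * opnorm phi)%E)].

Definition reflexive_space (V : normedModType R) : Prop :=
  forall Psi, @continuous_bidual V Psi ->
    exists v : V, forall phi, continuous_dual phi -> Psi phi = phi v.

(* A map defined on the open set [Om] is represented by a total function;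
   its values outside [Om] are irrelevant. *)
Definition continuously_differentiable_on {V W : normedModType R}
    (Om : set V) (F : V -> W) : Prop :=
  (forall x, Om x -> differentiable F x) /\
  (forall x, Om x ->
     opnorm (fun d => 'd F y d - 'd F x d) @[y --> x] --> 0%E).

Definition cone {W : normedModType R} (C : set W) : Prop :=
  forall (a : R) (c : W), 0 < a -> C c -> C (a *: c).

Section set_valued_maps.
Context {V W : normedModType R}.

Definition sv_range (S : V -> set W) : set W := \bigcup_d S d.

Definition sv_dom (S : V -> set W) : set V := [set d | S d !=set0].

Definition sv_inv (S : V -> set W) : W -> set V := fun w => [set d | S d w].

(* The distance from 0 to A, equal to +oo when A is empty. *)
Definition set_norm (A : set W) : \bar R := ereal_inf [set `|w|%:E | w in A].

Definition sv_norm (S : V -> set W) : \bar R :=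
  ereal_sup [set set_norm (S d) | d in [set d | sv_dom S d /\ `|d| <= 1]].

End set_valued_maps.

Section cone_inclusion.
Context {V W : normedModType R} (F : V -> W) (C : set W).

Definition Tmap (z : V) : V -> set W := fun d => [set 'd F z d - c | c in C].

Definition Tinv (z : V) : W -> set V := sv_inv (Tmap z).

Lemma TinvE (z : V) (w : W) : Tinv z w = [set d | C ('d F z d - w)].
Proof.
apply/seteqP; split => [d [c Cc <-]|d Cd] /=; first by rewrite subKr.
by exists ('d F z d - w); rewrite ?subKr.
Qed.

Definition robinson (z : V) : Prop := sv_range (Tmap z) = setT.

Definition newton_directions (z : V) : set V :=
  [set d | C (F z + 'd F z d) /\
           forall e, C (F z + 'd F z e) -> `|d| <= `|e|].

Definition newton_step (z z' : V) : Prop :=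
  [set z + d | d in newton_directions z] z'.

Definition newton_sequence (x0 : V) (x : nat -> V) : Prop :=
  x 0%N = x0 /\ forall k, newton_step (x k) (x k.+1).

End cone_inclusion.

Section rates_of_convergence.
Context {V : normedModType R}.
Implicit Types (u : nat -> V) (l : V).

Definition Q_linear u l : Prop :=
  u @ \oo --> l /\
  exists q : R, [/\ 0 < q, q < 1 &
    \forall k \near \oo, `|u k.+1 - l| <= q * `|u k - l|].

Definition Q_quadratic u l : Prop :=
  u @ \oo --> l /\
  exists M : R, \forall k \near \oo, `|u k.+1 - l| <= M * `|u k - l| ^+ 2.

End rates_of_convergence.

Definition R_linear {V : normedModType R} (u : nat -> V) (l : V) : Prop :=
  exists e : nat -> R, Q_linear e 0 /\ forall k, `|u k - l| <= e k.

(* The polynomial is considered on the whole line, so that its derivative at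
   the endpoint 0 of [0, +oo[ is the two-sided one. *)
Definition majorant (L b : R) : R -> R := fun t => L * t ^+ 2 / 2 - t + b.

Definition tstar (L b : R) : R := (1 - Num.sqrt (1 - 2 * b * L)) / L.

Definition scalar_newton (f : R -> R) (t0 : R) : nat -> R :=
  fun k => iter k (fun t => t - f t / derive1 f t) t0.

End banach_spaces.

(* Main.v *)
(* Write [p w] for the least norm of a [d] with [F'(xt) d - w] in [C]. In a reflexive
   space bounded sequences have weak cluster points (limits along an ultrafilter
   define an element of the bidual), and a closed convex set contains them by
   Hahn-Banach separation; hence [p] is attained and its sublevel sets are closed
   and convex. Three consequences drive the proof:
   - a Neumann-type iteration bounds the least [d] with [F'(z) d - w] in [C] by
     [p w / (1 - L |z - xt|)];
   - separating from a sublevel set of [p] reduces the integral bound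
     [p (- (F z' - F z - F'(z) (z' - z))) <= L |z' - z|^2 / 2] to the scalar mean
     value theorem;
   - as the current Newton inclusion puts [F z + F'(z) (z' - z)] in the cone [C], the
     next step is at most [L/2 |z' - z|^2 / (1 - L |z' - xt|)], which is exactly the
     recursion of the scalar steps, so [t] majorizes [x] by induction. *)
From HB Require Import structures.
Require Import Defs.
From mathcomp Require Import all_boot all_order all_algebra.
From mathcomp Require Import all_classical all_reals all_analysis.
From mathcomp Require Import ring lra.

Import Order.TTheory GRing.Theory Num.Theory.
Import numFieldNormedType.Exports.
Local Open Scope classical_set_scope.
Local Open Scope ring_scope.

(** * Sublinear functionals and the Hahn-Banach theorem *)

Definition sublinear {R : realType} {V : lmodType R} (p : V -> R) : Prop :=
  (forall x y, p (x + y) <= p x + p y) /\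
  (forall a x, 0 < a -> p (a *: x) <= a * p x).

Lemma sublinear0 (R : realType) (V : lmodType R) (p : V -> R) :
  sublinear p -> p 0 = 0.
Proof.
move=> [padd phom]; have := padd 0 0; rewrite addr0.
by have := phom 2^-1 0; rewrite scaler0 => /(_ ltac:(lra)); lra.
Qed.

Lemma sublinearZ (R : realType) (V : lmodType R) (p : V -> R) a x :
  sublinear p -> 0 <= a -> p (a *: x) = a * p x.
Proof.
move=> sp; rewrite le_eqVlt => /predU1P[<-|a0].
  by rewrite scale0r mul0r sublinear0.
have [padd phom] := sp; apply/eqP; rewrite eq_le phom//=.
have := phom a^-1 (a *: x); rewrite invr_gt0 scalerA mulVf ?gt_eqF// scale1r.
by move=> /(_ a0); rewrite ler_pdivlMl.
Qed.

Lemma sublinearN (R : realType) (V : lmodType R) (p : V -> R) x :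
  sublinear p -> - p (- x) <= p x.
Proof.
move=> sp; have := sp.1 x (- x); rewrite subrr sublinear0//; lra.
Qed.

(* [p] is compared with the sublinear functionals
   [x |-> inf_(t >= 0) (p (x + t y) - t p y)] below it. *)
Lemma minimal_sublinear_linear (R : realType) (V : lmodType R) (p : V -> R) :
  sublinear p ->
  (forall q, sublinear q -> (forall x, q x <= p x) -> q = p) ->
  linear (p : V -> R^o).
Proof.
move=> sp pmin.
have padd x y : p (x + y) = p x + p y.
  apply/eqP; rewrite eq_le sp.1 /=.
  pose A z := [set p (z + t *: y) - t * p y | t in [set t : R | 0 <= t]].
  have A0 z : has_inf (A z).
    split; first by exists (p (z + 0 *: y) - 0 * p y); exists 0; rewrite /= ?lexx.
    exists (- p (- z)) => _ [t /= t0 <-].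
    have := sp.1 (z + t *: y) (- z); rewrite addrAC subrr add0r sublinearZ//.
    lra.
  pose q z := inf (A z).
  have qle z t : 0 <= t -> q z <= p (z + t *: y) - t * p y.
    by move=> t0; apply: ge_inf; [exact: (A0 z).2|exists t].
  have qge z c : (forall t, 0 <= t -> c <= p (z + t *: y) - t * p y) -> c <= q z.
    by move=> h; apply: lb_le_inf; [exact: (A0 z).1|move=> _ [t /= t0 <-]; exact: h].
  have qp : q = p.
    apply: pmin; last first.
      by move=> z; have := qle z 0 (lexx _); rewrite scale0r addr0 mul0r subr0.
    split => [z w|a z a0].
      rewrite -lerBlDr; apply: (qge _ _) => t t0; rewrite lerBlDr -lerBlDl.
      apply: qge => s s0; rewrite lerBlDr.
      apply: le_trans (qle _ (t + s) _) _; first exact: addr_ge0.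
      have := sp.1 (z + t *: y) (w + s *: y).
      by rewrite addrACA -scalerDl; lra.
    rewrite -ler_pdivrMl//; apply: (qge _ _) => t t0; rewrite ler_pdivrMl//.
    apply: le_trans (qle _ (a * t) _) _; first exact: mulr_ge0 (ltW a0) t0.
    by rewrite -scalerA -scalerDr (sublinearZ _ _ _ _ _ sp (ltW a0)) mulrBr mulrA.
  by have := qle x 1 ler01; rewrite qp scale1r mul1r; lra.
have pN x : p (- x) = - p x.
  by have := padd x (- x); rewrite subrr sublinear0//; lra.
move=> a x y; rewrite padd; congr (_ + _).
have [a0|a0] := leP 0 a; first exact: sublinearZ.
by rewrite -[a in a *: x]opprK scaleNr pN sublinearZ ?oppr_ge0 ?(ltW a0)// -mulNr opprK.
Qed.

(** Zorn's lemma is applied to the sublinear functionals below [q], ordered downwards. A minimal one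
    is linear by [minimal_sublinear_linear], so no extension from subspaces is involved. *)
Lemma hahn_banach_sublinear (R : realType) (V : lmodType R) (q : V -> R) :
  sublinear q ->
  exists phi : V -> R^o, linear phi /\ forall x, phi x <= q x.
Proof.
move=> sq.
pose T := {p : V -> R | sublinear p /\ forall x, p x <= q x}.
(* This lower bound does not depend on the functional, so the pointwise infimum of a chain is
   finite. *)
have Tlow (s : T) x : - q (- x) <= sval s x.
  case: s => p [sp pq] /=; apply: le_trans (sublinearN _ _ _ x sp).
  by rewrite lerN2.
pose rel (s t : T) := `[< forall x, sval t x <= sval s x >].
have [||||[p [sp pq]] pmin] := @Zorn T rel.
- by move=> s; apply/asboolP.
- move=> s t u /asboolP st /asboolP tu; apply/asboolP => x.
  exact: le_trans (tu x) (st x).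
- move=> [s ps] [t pt] /asboolP/= st /asboolP/= ts.
  by apply: eq_exist; apply/funext => x; apply/eqP; rewrite eq_le st ts.
- move=> A Atot; have [[s0 As0]|A0] := pselect (A !=set0); last first.
    by exists (exist _ q (conj sq (fun x => lexx _))) => s As; case: A0; exists s.
  pose B x := [set sval s x | s in A].
  have B0 x : has_inf (B x).
    split; first by exists (sval s0 x), s0.
    by exists (- q (- x)) => _ [s As <-].
  pose p x := inf (B x).
  have ple s x : A s -> p x <= sval s x.
    by move=> As; apply: ge_inf; [exact: (B0 x).2|exists s].
  have pge x c : (forall s, A s -> c <= sval s x) -> c <= p x.
    by move=> h; apply: lb_le_inf; [exact: (B0 x).1|move=> _ [s As <-]; exact: h].
  have sp : sublinear p.
    split => [x y|a x a0].
      rewrite -lerBlDr; apply: (pge _ _) => s As; rewrite lerBlDr -lerBlDl.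
      apply: pge => t At; rewrite lerBlDr.
      (* Subadditivity of the infimum needs one functional at both points; the chain is total, so
         the smaller of the two serves. *)
      have [/asboolP st|/asboolP ts] := Atot _ _ As At.
        apply: le_trans (ple _ _ At) _; apply: le_trans ((svalP t).1.1 x y) _.
        by rewrite addrC lerD2l.
      apply: le_trans (ple _ _ As) _; apply: le_trans ((svalP s).1.1 x y) _.
      by rewrite addrC lerD2r.
    rewrite -ler_pdivrMl//; apply: pge => s As; rewrite ler_pdivrMl//.
    exact: le_trans (ple _ _ As) ((svalP s).1.2 a x a0).
  have pq x : p x <= q x by apply: le_trans (ple _ _ As0) ((svalP s0).2 x).
  by exists (exist _ p (conj sp pq)) => s As; apply/asboolP => x /=; exact: ple.
- exists p; split => //; apply: minimal_sublinear_linear => // r sr rp.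
  have rq x : r x <= q x := le_trans (rp x) (pq x).
  by have /(congr1 sval) := pmin (exist _ r (conj sr rq)) ltac:(by apply/asboolP).
Qed.

Lemma linear_bundle (R : realType) (V : lmodType R) (phi : V -> R^o) :
  linear phi -> exists f : {linear V -> R^o}, phi = f.
Proof.
move=> lphi.
pose f : {linear V -> R^o} :=
  HB.pack phi (GRing.isLinear.Build R V R^o *:%R phi lphi).
by exists f.
Qed.

(** * Closed convex sets and their separation from a point *)

Lemma convex_setP (R : realType) (V : lmodType R) (K : set V) :
  convex_set K <->
  forall (a b : R) x y, 0 <= a -> 0 <= b -> a + b = 1 -> K x -> K y ->
    K (a *: x + b *: y).
Proof.
split=> [cK a b x y a0 b0 ab Kx Ky|cK x y t /set_mem Kx /set_mem Ky].
  have a1 : a <= 1 by lra.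
  have <- : 1 - a = b by lra.
  exact: set_mem (cK x y (Itv01 a0 a1) (mem_set Kx) (mem_set Ky)).
by apply/mem_set; apply: cK => //; [rewrite subr_ge0|rewrite addrC subrK].
Qed.

Lemma closed_dist_gt0 (R : realType) (V : normedModType R) (K : set V) (v : V) :
  closed K -> ~ K v -> exists2 eta : R, 0 < eta & forall k, K k -> eta <= `|k - v|.
Proof.
move=> cK Kv; have : nbhs v (~` K).
  by apply: open_nbhs_nbhs; split => //; exact: closed_openC.
move=> /nbhs_normP[e /= e0 he]; exists e => // k Kk; rewrite leNgt.
by apply/negP => kv; apply: (he k) => //=; rewrite distrC.
Qed.

(* Hahn-Banach is applied to [q x := inf_(t >= 0, k in K) (|x - t (k - v)| - t eta)],
   which is bounded by the norm and is at most [- eta] at every [k - v]. *)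
Lemma separation_closed_convex (R : realType) (V : normedModType R)
    (K : set V) (v : V) :
  closed K -> convex_set K -> ~ K v ->
  exists2 phi, continuous_dual (V:=V) phi &
    exists2 eta : R, 0 < eta & forall k, K k -> phi k <= phi v - eta.
Proof.
move=> cK /convex_setP vK Kv; have [[k0 Kk0]|K0] := pselect (K !=set0); last first.
  exists (fun=> 0).
    by split; [move=> a x y; rewrite scaler0 addr0|exact: cst_continuous].
  by exists 1 => // k Kk; case: K0; exists k.
have [eta eta0 etaK] := closed_dist_gt0 _ _ _ _ cK Kv.
pose D := [set tk : R * V | 0 <= tk.1 /\ K tk.2].
pose A x := [set `|x - tk.1 *: (tk.2 - v)| - tk.1 * eta | tk in D].
have A0 x : has_inf (A x).
  split; first by exists (`|x - 0 *: (k0 - v)| - 0 * eta); exists (0, k0) => //=; split => /=.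
  exists (- `|x|) => _ [[t k] [/= t0 Kk] <-] /=.
  have := ler_normB x (x - t *: (k - v)); rewrite subKr normrZ (ger0_norm t0).
  have := etaK _ Kk => /(ler_wpM2l t0) /=; lra.
pose q x := inf (A x).
have qle x t k : 0 <= t -> K k -> q x <= `|x - t *: (k - v)| - t * eta.
  by move=> t0 Kk; apply: ge_inf; [exact: (A0 x).2|exists (t, k)].
have qge x c : (forall t k, 0 <= t -> K k -> c <= `|x - t *: (k - v)| - t * eta) -> c <= q x.
  move=> h; apply: lb_le_inf; first exact: (A0 x).1.
  by move=> _ [[t k] /= [t0 Kk] <-]; exact: h.
have sq : sublinear q.
  split=> [x y|a x a0].
    rewrite -lerBlDr; apply: (qge _ _) => t k t0 Kk; rewrite lerBlDr -lerBlDl.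
    apply: qge => s l s0 Kl; rewrite lerBlDr.
    (* The pairs [(t, k)] and [(s, l)] merge into weight [t + s] at the weighted mean of [k] and
       [l]. The mean is undefined when [t + s] vanishes, and then both weights are 0. *)
    have [ts|ts] := eqVneq (t + s) 0.
      have -> : t = 0 by lra.
      have -> : s = 0 by lra.
      apply: le_trans (qle _ 0 k0 _ _) _ => //.
      by rewrite !scale0r !mul0r !subr0 addrC; exact: ler_normD.
    have ts0 : 0 < t + s by lra.
    apply: le_trans (qle _ (t + s) (t / (t + s) *: k + s / (t + s) *: l) _ _) _.
    - exact: ltW.
    - apply: vK => //; rewrite ?divr_ge0// ?ltW//.
      by rewrite -mulrDl divff.
    - have -> : (t + s) *: (t / (t + s) *: k + s / (t + s) *: l - v) =
          t *: (k - v) + s *: (l - v).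
        rewrite !scalerBr scalerDr !scalerA !mulrA ![(t + s) * _]mulrC !mulfK//.
        by rewrite scalerDl opprD addrACA.
      have := ler_normD (x - t *: (k - v)) (y - s *: (l - v)).
      rewrite addrACA -opprD; lra.
  rewrite -ler_pdivrMl//; apply: (qge _ _) => t k t0 Kk; rewrite ler_pdivrMl//.
  apply: le_trans (qle _ (a * t) k _ Kk) _; first exact: mulr_ge0 (ltW a0) t0.
  by rewrite -scalerA -scalerBr normrZ gtr0_norm// mulrBr mulrA.
have [phi [lphi phiq]] := hahn_banach_sublinear _ _ _ sq.
have [f ef] := linear_bundle _ _ _ lphi; rewrite {}ef in lphi phiq.
have fle x : f x <= `|x|.
  apply: le_trans (phiq x) _; have := qle x 0 k0 (lexx _) Kk0.
  by rewrite scale0r mul0r !subr0.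
exists f; first split => //.
  move=> x; apply/cvgrPdist_lt => e e0; near=> y.
  rewrite -linearB; apply: (@le_lt_trans _ _ `|x - y|).
    by rewrite ler_norml fle andbT lerNl -linearN -normrN fle.
  by near: y; apply: cvgr_dist_lt.
exists eta => // k Kk.
have := phiq (k - v); rewrite linearB/=.
have := qle (k - v) 1 k ler01 Kk; rewrite scale1r subrr normr0 mul1r; lra.
Unshelve. all: by end_near. Qed.

(** * Weak cluster points in reflexive spaces *)

(** Compactness of the segment gives a cluster point, and a cluster point of an ultrafilter is a
    limit, since each set or its complement belongs to the filter. *)
Lemma ultrafilter_bounded_cvg (R : realType) (T : Type) (U : set_system T)
    (u : T -> R^o) (M : R) :
  UltraFilter U -> (forall n, `|u n| <= M) -> cvg (u @ U).
Proof.
move=> UU uM.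
have UI : (u @ U) `[-M, M]%classic.
  by apply: (@filterE _ U) => n /=; rewrite /= in_itv/= -ler_norml; exact: uM.
have [l [_ ul]] := @segment_compact R (-M) M (u @ U) _ UI.
apply/cvg_ex; exists l => A lA /=.
have [//|UA] := in_ultra_setVsetC (u @^-1` A) UU.
by have [x []] := ul (~` A) A UA lA.
Qed.

Lemma continuous_dual_bounded (R : realType) (V : normedModType R)
    (phi : V -> R^o) :
  continuous_dual (V:=V) phi ->
  exists c : R, forall x, `|phi x| <= c * `|x|.
Proof.
move=> [lphi cphi]; have [f ef] := linear_bundle _ _ _ lphi.
move: cphi; rewrite ef => /linear_bounded_continuous/linear_boundedP/pinfty_ex_gt0.
by move=> [c _ hc]; exists c.
Qed.

(* The limits of [phi \o d] along an ultrafilter form an element of the bidual. *)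
Lemma reflexive_weak_cluster (R : realType) (V : normedModType R)
    (d : nat -> V) (M : R) :
  reflexive_space V -> (forall n, `|d n| <= M) ->
  exists2 U : set_system nat, ProperFilter U /\ \oo `<=` U &
    exists v, forall phi, continuous_dual (V:=V) phi ->
      phi \o d @ U --> phi v.
Proof.
move=> rV dM.
have [U [UU oU]] := ultraFilterLemma (F := \oo) _.
exists U; first by split => //; exact: ultra_proper.
pose N := Num.max M 1.
have N0 : 0 < N by rewrite lt_max ltr01 orbT.
have dN n : `|d n| <= N by rewrite le_max dM.
have bnd phi : continuous_dual (V:=V) phi ->
    forall n, (`|phi (d n)|%:E <= N%:E * opnorm phi)%E.
  move=> [lphi _] n; have [f ef] := linear_bundle _ _ _ lphi.
  rewrite ef -lee_pdivrMl// -EFinM; apply: ereal_sup_ubound.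
  exists (N^-1 *: d n) => /=; last by rewrite linearZ/= normrZ gtr0_norm ?invr_gt0.
  by rewrite normrZ gtr0_norm ?invr_gt0// mulrC ler_pdivrMr// mul1r.
have cv phi : continuous_dual (V:=V) phi -> cvg (phi \o d @ U).
  move=> /continuous_dual_bounded[c hc].
  apply: (@ultrafilter_bounded_cvg _ _ _ _ (`|c| * N)) => // n.
  apply: le_trans (hc _) _; apply: le_trans (ler_wpM2l (normr_ge0 c) (dN n)).
  by rewrite ler_wpM2r// ler_norm.
pose Psi (phi : V -> R^o) : R^o := lim (phi \o d @ U).
have [v hv] : exists v, forall phi, continuous_dual phi -> Psi phi = phi v.
  apply: rV; split.
    move=> a phi psi dphi dpsi; apply/cvg_lim => //.
    by apply: cvgD; [apply: cvgZr; exact: cv|exact: cv].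
  exists N => phi dphi.
  (* [opnorm] is an extended real: at +oo the bound is trivial, and -oo contradicts the bound at
     [d 0]. *)
  have := bnd _ dphi; case: (opnorm phi) => [s| |] h.
  - rewrite lee_fin; apply: (@closed_cvg _ _ U _ (fun n => `|phi (d n)|) [set x | x <= N * s]).
    + exact: closed_le.
    + by apply: filterE => n; exact: h.
    + by apply: cvg_norm; exact: cv.
  - by rewrite mulry gtr0_sg// mul1e leey.
  - by have := h 0; rewrite mulrNy gtr0_sg// mul1e.
by exists v => phi dphi; rewrite -hv//; exact: cv.
Qed.

(** A functional separating [v] from [K] would stay below [phi v - eta] along [d], hence also in the
    limit. *)
Lemma weak_limit_closed_convex (R : realType) (V : normedModType R)
    (U : set_system nat) (d : nat -> V) (v : V) (K : set V) :
  ProperFilter U -> closed K -> convex_set K ->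
  (forall phi, continuous_dual (V:=V) phi -> phi \o d @ U --> phi v) ->
  (\forall n \near U, K (d n)) -> K v.
Proof.
move=> UU cK vK dv dK; apply: contrapT => Kv.
have [phi dphi [eta eta0 sep]] := separation_closed_convex _ _ _ _ cK vK Kv.
have : [set x : R^o | x <= phi v - eta] (phi v).
  apply: (@closed_cvg _ _ U UU (phi \o d) _ _ _ _ (dv _ dphi)).
    exact: closed_le.
  by apply: filterS dK => n; exact: sep.
by rewrite /=; lra.
Qed.

Lemma convex_closed_ball (R : realType) (V : normedModType R) (rho : R) :
  convex_set [set v : V | `|v| <= rho].
Proof.
apply/convex_setP => a b x y a0 b0 ab /= xr yr.
apply: le_trans (ler_normD _ _) _; rewrite !normrZ !ger0_norm//.
rewrite -[leRHS]mul1r -ab mulrDl.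
by rewrite lerD// ler_wpM2l.
Qed.

Lemma closed_norm_le (R : realType) (V : normedModType R) (rho : R) :
  closed [set v : V | `|v| <= rho].
Proof.
apply: (@preimage_closed V R (fun v => `|v|) [set x | x <= rho]) => [v _|].
  exact: norm_continuous.
exact: closed_le.
Qed.

(** * Sublevel sets of the least-norm solution of a cone inclusion *)

(** For [A] the derivative at the starting point this is the set where [p] is at most [rho].
    Requiring a witness of norm at most [rho] builds attainment into the definition. *)
Definition reach {R : realType} {X Y : normedModType R} (A : X -> Y) (C : set Y)
    (rho : R) : set Y :=
  [set w | exists2 d, `|d| <= rho & C (A d - w)].

(** A weak cluster point of the bounded solutions [d n] solves the limit inclusion. Constant radii
    give closedness of [reach]; radii decreasing to an infimum give its attainment. *)
Lemma reach_cvg (R : realType) (X Y : normedModType R) (A : {linear X -> Y})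
    (C : set Y) (d : nat -> X) (w : nat -> Y) (r : nat -> R) (w0 : Y) (r0 : R) :
  reflexive_space X -> continuous A -> closed C -> convex_set C ->
  (forall n, `|d n| <= r n) -> (forall n, C (A (d n) - w n)) ->
  r @ \oo --> r0 -> w @ \oo --> w0 -> reach A C r0 w0.
Proof.
move=> rX cA cC vC dr dC rr0 ww0.
have [M rM] : exists M, forall n, r n <= M.
  have /cvg_seq_bounded/pinfty_ex_gt0[M _ hM] : cvgn r by apply/cvg_ex; exists r0.
  by exists M => n; apply: le_trans (ler_norm _) (hM n I).
have [U [UU oU] [v dv]] :=
  reflexive_weak_cluster _ _ d M rX (fun n => le_trans (dr n) (rM n)).
have w0U : w @ U --> w0 by apply: cvg_trans ww0; exact: cvg_app.
exists v.
  (* For every [e] the tail of [d] lies in the ball of radius [r0 + e], which is closed and convex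
     and so keeps weak limits. *)
  apply/ler_addgt0Pr => e e0.
  apply: (weak_limit_closed_convex _ _ U d v [set v | `|v| <= r0 + e]) => //.
  - exact: closed_norm_le.
  - exact: convex_closed_ball.
  - apply: oU; near=> n => /=; apply: le_trans (dr n) _.
    by near: n; apply: cvgr_le rr0 _ _; rewrite ltrDl.
(* Since [d] converges only weakly, [A (d n)] is tested against one separating functional, whose
   composite with [A] is in the dual of [X]. *)
apply: contrapT => Cv.
have [phi dphi [eta eta0 sep]] := separation_closed_convex _ _ _ _ cC vC Cv.
have [lphi cphi] := dphi; have [f ef] := linear_bundle _ _ _ lphi.
have dphiA : continuous_dual (phi \o A).
  split; first by move=> a x y; rewrite /= linearP lphi.
  by move=> x; apply: continuous_comp; [exact: cA|exact: cphi].
have lim : (fun n => phi (A (d n)) - phi (w n)) @ U --> phi (A v) - phi w0.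
  apply: cvgB; first exact: dv dphiA.
  by apply: continuous_cvg => //; exact: cphi.
have : [set x : R^o | x <= phi (A v - w0) - eta] (phi (A v) - phi w0).
  apply: (@closed_cvg _ _ U UU _ _ _ _ _ lim); first exact: closed_le.
  by apply: filterE => n /=; have := sep _ (dC n); rewrite ef linearB.
by rewrite /= ef linearB/=; lra.
Unshelve. all: by end_near. Qed.

Lemma convex_cone_add (R : realType) (Y : normedModType R) (C : set Y) x y :
  convex_set C -> cone C -> C x -> C y -> C (x + y).
Proof.
move=> /convex_setP vC kC Cx Cy.
have -> : x + y = 2 *: (2^-1 *: x + 2^-1 *: y).
  by rewrite scalerDr !scalerA divff// !scale1r.
by apply: kC => //; apply: vC => //; lra.
Qed.

(** [cone] allows positive scalars only, so the origin is reached as the limit of [c / (n + 1)]. *)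
Lemma closed_cone0 (R : realType) (Y : normedModType R) (C : set Y) :
  C !=set0 -> closed C -> cone C -> C 0.
Proof.
move=> [c Cc] cC kC; rewrite -(scale0r c).
apply: (@closed_cvg _ _ \oo _ (fun n => n.+1%:R^-1 *: c)) => //.
  by apply: nearW => n; apply: kC.
by apply: cvgZl; exact: cvg_harmonic.
Qed.

Lemma closed_seqP (R : realType) (V : normedModType R) (K : set V) :
  (forall (u : nat -> V) v, (forall n, K (u n)) -> u @ \oo --> v -> K v) ->
  closed K.
Proof.
move=> hK v vK.
have /choice[u hu] (n : nat) : exists x, K x /\ `|v - x| < n.+1%:R^-1.
  have [|x [Kx vx]] := vK (ball v n.+1%:R^-1); first by apply: nbhsx_ballx.
  by exists x; split => //; move: vx; rewrite -ball_normE.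
apply: (hK u) => [n|]; first exact: (hu n).1.
apply/cvgrPdist_lt => e e0; near=> n; apply: lt_trans (hu n).2 _.
near: n; have := @cvg_harmonic R => /cvgrPdist_lt/(_ e e0).
by apply: filterS => n; rewrite sub0r normrN ger0_norm// /harmonic invr_ge0.
Unshelve. all: by end_near. Qed.

Section reach_theory.
Context {R : realType} {X Y : normedModType R}.
Variables (A : {linear X -> Y}) (C : set Y).
Hypotheses (rX : reflexive_space X) (cA : continuous A).
Hypotheses (C0 : C !=set0) (cC : closed C) (vC : convex_set C) (kC : cone C).

Lemma reach_closed rho : closed (reach A C rho).
Proof.
apply: closed_seqP => w w0 hw ww0.
have /choice[d hd] n : exists d, `|d| <= rho /\ C (A d - w n).
  by have [d ? ?] := hw n; exists d.
apply: (reach_cvg _ _ _ _ _ d w (fun=> rho)) => //; try by move=> n; case: (hd n).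
exact: cvg_cst.
Qed.

Lemma reach_convex rho : convex_set (reach A C rho).
Proof.
apply/convex_setP => a b x y a0 b0 ab [d dr Cd] [e er Ce].
exists (a *: d + b *: e).
  by have /convex_setP := convex_closed_ball R X rho; exact.
rewrite linearD !linearZ/= opprD addrACA -!scalerBr.
by move/convex_setP : vC; exact.
Qed.

Lemma reachZ a r w : 0 < a -> reach A C r w -> reach A C (a * r) (a *: w).
Proof.
move=> a0 [d dr Cd]; exists (a *: d); first by rewrite normrZ gtr0_norm// ler_pM2l.
by rewrite linearZ/= -scalerBr; exact: kC.
Qed.

Lemma reach0 r : 0 <= r -> reach A C r 0.
Proof. by move=> r0; exists 0; rewrite ?normr0// linear0 subrr; exact: closed_cone0. Qed.

Lemma reach_ler r s w : r <= s -> reach A C r w -> reach A C s w.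
Proof. by move=> rs [d dr Cd]; exists d => //; exact: le_trans rs. Qed.

(* Solving successively for the residuals gives bounded partial sums that satisfy
   the inclusion for [B] up to an error tending to 0; weak compactness in
   [reach_cvg] then replaces any open mapping theorem. *)
Lemma reach_perturbation (B : {linear X -> Y}) (q r : R) (w : Y) :
  continuous B -> 0 <= q < 1 ->
  (forall d, reach A C (q * `|d|) (B d - A d)) ->
  reach A C r w -> reach B C (r / (1 - q)) w.
Proof.
move=> cB /andP[q0 q1] hBA [d0 d0r Cd0].
have r0 : 0 <= r := le_trans (normr_ge0 _) d0r.
(* [g d] is the correction for the residual left by [d]. The hypothesis is used at [- d] because the
   residual enters with the opposite sign. *)
have /choice[g hg] d : exists e, `|e| <= q * `|d| /\ C (A e + (B d - A d)).
  have [e er Ce] := hBA (- d); exists e; split; first by rewrite -(normrN d).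
  by move: Ce; rewrite !linearN/= -opprD opprK.
pose e n := iter n g d0.
have er n : `|e n| <= q ^+ n * r.
  elim: n => [|n ih]; first by rewrite expr0 mul1r.
  apply: le_trans (hg _).1 _; rewrite exprS -mulrA.
  exact: ler_wpM2l.
pose s n := \sum_(k < n.+1) e k.
have sr n : `|s n| <= r / (1 - q).
  apply: le_trans (ler_norm_sum _ _ _) _.
  apply: (@le_trans _ _ (\sum_(k < n.+1) q ^+ k * r)).
    by apply: ler_sum => k _; exact: er.
  have q'0 : 0 < 1 - q by lra.
  rewrite -mulr_suml mulrC ler_wpM2l// -[leRHS]mul1r ler_pdivlMr// mulrC.
  rewrite -opprB mulNr -subrX1 opprB gerBl.
  exact: exprn_ge0.
have cancel (a c v : Y) : a - v - (a - c) = c - v.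
  by rewrite opprB addrCA [_ - v - _]addrAC subrr sub0r.
have step (a h c v x : Y) : a - v - x + (c + x) = a + h - v - (h - c).
  rewrite [a + h - v]addrAC opprB [RHS]addrCA addrK [c + x]addrC [LHS]addrA.
  by rewrite subrK addrC.
(* Invariant: the partial sum solves the inclusion for [B] up to the residual of its last term;
   adding the inclusion for the next correction cancels this residual and leaves the next one. *)
have Cs n : C (B (s n) - w - (B (e n) - A (e n))).
  elim: n => [|n ih].
    by rewrite /s big_ord1/=; have -> := cancel (B d0) (A d0) w.
  rewrite [s n.+1]big_ord_recr/= linearD/= -/(s n).
  exact: (eq_ind _ C (convex_cone_add _ _ _ _ _ vC kC ih (hg (e n)).2) _
    (step (B (s n)) (B (g (e n))) (A (g (e n))) w (B (e n) - A (e n)))).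
have e0 : e @ \oo --> (0 : X).
  apply/cvgr0Pnorm_lt => eps eps0.
  have : (fun n => q ^+ n * r) @ \oo --> 0 * r.
    apply: cvgMl; apply: (@cvg_expr R q); by rewrite ger0_norm.
  rewrite mul0r => /cvgr0Pnorm_lt/(_ eps eps0); apply: filterS => n.
  by apply: le_lt_trans; apply: le_trans (er n) (ler_norm _).
apply: (reach_cvg _ _ _ B C s (fun n => w + (B (e n) - A (e n))) (fun=> r / (1 - q))) => //.
- by move=> n; rewrite opprD addrA.
- exact: cvg_cst.
- have lim : (fun n => w + (B (e n) - A (e n))) @ \oo --> w + (B 0 - A 0).
    apply: cvgD; first exact: cvg_cst.
    by apply: cvgB; apply: continuous_cvg => //; [exact: cB|exact: cA].
  have lim0 (a c : Y) : a = 0 -> c = 0 -> w + (a - c) = w.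
    by move=> -> ->; rewrite subr0 addr0.
  exact: (eq_ind _ (fun l => _ --> l) lim _ (lim0 _ _ (linear0 B) (linear0 A))).
Qed.

End reach_theory.

(** * Derivatives along segments and a mean value theorem for convex sets *)

Lemma is_derive_linear_comp (R : realType) (V W : normedModType R)
    (f : {linear V -> W}) (g : R -> V) (t : R) (dg : V) :
  continuous f -> is_derive t 1 g dg -> is_derive t 1 (f \o g) (f dg).
Proof.
move=> cf dg_; have [/cvg_ex[l hl] dgE] := dg_.
have ll : l = dg by rewrite -dgE; apply/esym/cvg_lim.
rewrite {}ll in hl.
suff H : h^-1 *: ((f \o g) (h *: 1 + t) - (f \o g) t) @[h --> 0^'] --> f dg.
  apply: DeriveDef; first by apply/cvg_ex; exists (f dg).
  exact/cvg_lim.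
have lim : f (h^-1 *: ((g \o shift t) (h *: 1) - g t)) @[h --> 0^'] --> f dg.
  by apply: continuous_cvg => //; exact: cf.
apply: cvg_trans lim; apply: near_eq_cvg; apply: nearW => h /=.
by rewrite linearZ linearB.
Qed.

Lemma is_derive_line (R : realType) (V W : normedModType R) (F : V -> W)
    (x d : V) (t : R) :
  differentiable F (x + t *: d) ->
  is_derive t 1 (fun t => F (x + t *: d)) ('d F (x + t *: d) d).
Proof.
move=> dF; have /cvg_ex[l hl] := @diff_derivable _ _ _ F (x + t *: d) d dF.
have ll : l = 'd F (x + t *: d) d by rewrite -deriveE//; apply/esym/cvg_lim.
rewrite {}ll in hl.
have H : h^-1 *: (F (x + (h *: 1 + t) *: d) - F (x + t *: d)) @[h --> 0^'] -->
    'd F (x + t *: d) d.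
  apply: cvg_trans hl; apply: near_eq_cvg; apply: nearW => h /=.
  by rewrite scaler1 scalerDl addrCA.
apply: DeriveDef; first by apply/cvg_ex; exists ('d F (x + t *: d) d).
exact/cvg_lim.
Qed.

(** The weight [2 * t] has integral 1 over the unit interval, so [g 1 - g 0] is an average of the
    values [s t]. Separation turns this into the scalar mean value theorem and avoids vector
    integrals. *)
Lemma convex_mean_value (R : realType) (Y : normedModType R) (S : set Y)
    (g s : R -> Y) :
  closed S -> convex_set S ->
  (forall t : R, 0 <= t <= 1 -> is_derive t 1 g ((2 * t) *: s t)) ->
  (forall t : R, 0 < t < 1 -> S (s t)) -> S (g 1 - g 0).
Proof.
move=> cS vS dg Ss; apply: contrapT => nS.
have [phi [lphi cphi] [eta eta0 sep]] := separation_closed_convex _ _ _ _ cS vS nS.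
have [f ef] := linear_bundle _ _ _ lphi; rewrite ef in cphi sep.
pose c := f (g 1 - g 0) - eta.
(* On [S] the functional is at most [c], so [h] has derivative at most 0 inside the interval,
   whereas [h 1 - h 0 = eta]. *)
pose h (t : R) : R := f (g t) - c * t ^+ 2.
have dh (t : R) : 0 <= t <= 1 -> is_derive t 1 h (2 * t * (f (s t) - c)).
  move=> t01; have := is_derive_linear_comp _ _ _ _ _ _ _ cphi (dg t t01).
  move=> dfg.
  have hE : h = (f \o g) - c \*: (id ^+ 2) by apply/funext => z; rewrite /h /= !fctE.
  rewrite hE; apply: is_derive_eq.
  by rewrite linearZ /= /GRing.scale /=; ring.
have hder (t : R) : t \in `]0, 1[%R -> is_derive t 1 h (2 * t * (f (s t) - c)).
  by rewrite in_itv/= => /andP[t0 t1]; apply: dh; rewrite !ltW.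
have hcont : {within `[0, 1], continuous h}.
  apply: derivable_within_continuous => t; rewrite in_itv/= => t01.
  by case: (dh t t01).
have [t] := MVT ltr01 hder hcont.
rewrite in_itv/= => t01; have [t0 t1] := andP t01.
have := sep _ (Ss _ t01); rewrite -/c => fsc.
have : 2 * t * (f (s t) - c) <= 0 by rewrite pmulr_rle0 ?subr_le0//; lra.
rewrite /h subr0 mulr1 => /[swap] <-.
by rewrite expr0n/= mulr0 subr0 expr1n mulr1 /c linearB/=; lra.
Qed.

Lemma cvg_add_harmonic (R : realType) (c : R) :
  (fun n => c + harmonic n) @ \oo --> c.
Proof.
have : (fun n => c + harmonic n) @ \oo --> c + 0.
  by apply: cvgD; [exact: cvg_cst|exact: cvg_harmonic].
by rewrite addr0.
Qed.

(** * From norms of set-valued maps to attained solutions *)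

Section cone_inclusion_reach.
Context {R : realType} {X Y : completeNormedModType R}.
Variables (F : X -> Y) (C : set Y).
Hypotheses (rX : reflexive_space X).
Hypotheses (C0 : C !=set0) (cC : closed C) (vC : convex_set C) (kC : cone C).

(** [set_norm] is an infimum; solutions of norm at most [c + 1 / (n + 1)] exist, and [reach_cvg]
    yields one of norm at most [c]. *)
Lemma set_norm_reach z w c :
  differentiable F z -> (set_norm (Tinv F C z w) <= c%:E)%E ->
  reach ('d F z) C c w.
Proof.
move=> dF wc.
have /choice[d hd] (n : nat) : exists d, `|d| <= c + harmonic n /\ C ('d F z d - w).
  have : (set_norm (Tinv F C z w) < (c + harmonic n)%:E)%E.
    by apply: le_lt_trans wc _; rewrite lte_fin ltrDl /harmonic invr_gt0.
  by move=> /ereal_inf_lt[_ [d + <-]]; rewrite TinvE lte_fin => Cd /ltW; exists d.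
apply: (reach_cvg _ _ _ _ _ d (fun=> w) (fun n => c + harmonic n)) => //.
- exact: diff_continuous.
- by move=> n; exact: (hd n).1.
- by move=> n; exact: (hd n).2.
- exact: cvg_add_harmonic.
- exact: cvg_cst.
Qed.

(** The bound is scaled up from the unit vector along [d]. Robinson's condition puts that vector in
    the domain over which [sv_norm] takes its supremum. *)
Lemma sv_norm_reach z (D : {linear X -> Y}) l d :
  differentiable F z -> robinson F C z ->
  (sv_norm (fun e => Tinv F C z (D e)) <= l%:E)%E ->
  reach ('d F z) C (l * `|d|) (D d).
Proof.
move=> dF rob hl; have [->|d0] := eqVneq d 0.
  by rewrite linear0 normr0 mulr0; exact: reach0.
have nd : 0 < `|d| by rewrite normr_gt0.
have -> : D d = `|d| *: D (`|d|^-1 *: d).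
  by rewrite linearZ scalerA divff ?scale1r// gt_eqF.
rewrite mulrC; apply: reachZ => //; apply: set_norm_reach => //.
apply: le_trans hl; apply: ereal_sup_ubound.
exists (`|d|^-1 *: d) => //=; split; last first.
  by rewrite normrZ normfV normr_id mulVf// gt_eqF.
have : sv_range (Tmap F C z) (D (`|d|^-1 *: d)) by rewrite rob.
by move=> [e _ he]; exists e.
Qed.

(** The integral of [k * t] over the unit interval is [k / 2]. Dividing the slope by [2 * t] places
    it in [reach A C (k / 2)] for every [t], as [convex_mean_value] requires. *)
Lemma linearization_error_reach (A : {linear X -> Y}) x d k :
  continuous A -> 0 <= k ->
  (forall t : R, 0 <= t <= 1 -> differentiable F (x + t *: d)) ->
  (forall t : R, 0 < t < 1 ->
     reach A C (k * t) ('d F x d - 'd F (x + t *: d) d)) ->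
  reach A C (k / 2) ('d F x d - (F (x + d) - F x)).
Proof.
move=> cA k0 dF hd.
pose g (t : R) := t *: 'd F x d - F (x + t *: d).
pose s (t : R) := (2 * t)^-1 *: ('d F x d - 'd F (x + t *: d) d).
have -> : 'd F x d - (F (x + d) - F x) = g 1 - g 0.
  by rewrite /g !scale1r !scale0r addr0 sub0r opprK opprB addrA addrAC.
apply: (@convex_mean_value _ _ _ _ s).
- exact: reach_closed.
- exact: reach_convex.
- move=> t t01; have [t0 t1] := andP t01.
  have dl : is_derive t 1 (fun t => t *: 'd F x d) ('d F x d).
    have -> : (fun t => t *: 'd F x d) = fun t => 0 + t *: 'd F x d.
      by apply/funext => u; rewrite add0r.
    have := @is_derive_line _ Y Y id 0 ('d F x d) t ltac:(exact: ex_diff).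
    by have -> : ('d (@id Y) (0 + t *: 'd F x d) : Y -> Y) = id by exact: diff_val.
  have := is_deriveB dl (is_derive_line _ _ _ F x d t (dF t t01)).
  (* At [t = 0] the inverse in [s] has the default value 0, which agrees with the derivative of [g],
     equal to 0 there. *)
  rewrite scalerA; have [->|tn0] := eqVneq t 0; last first.
    by rewrite divff ?scale1r// mulf_neq0.
  by rewrite scale0r addr0 subrr mulr0 mul0r scale0r.
- move=> t t01; have [t0 t1] := andP t01.
  have -> : k / 2 = (2 * t)^-1 * (k * t).
    by field; rewrite gt_eqF.
  by apply: reachZ; [|by rewrite invr_gt0; lra|exact: hd].
Qed.

(** The given solution makes the set of feasible norms nonempty; a minimizing sequence then yields a
    direction whose norm is the infimum. *)
Lemma newton_directions_exist z r :
  differentiable F z -> reach ('d F z) C r (- F z) ->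
  newton_directions F C z !=set0.
Proof.
move=> dF [d0 d0r Cd0].
pose S := [set `|d| | d in [set d | C ('d F z d - - F z)]].
have S0 : has_inf S by split; [exists `|d0|, d0|exists 0 => _ [d _ <-]].
have /choice[d hd] (n : nat) :
    exists d, `|d| <= inf S + harmonic n /\ C ('d F z d - - F z).
  have [|_ [d Cd <-] /ltW dn] := @inf_adherent _ S (harmonic n) _ S0.
    by rewrite /harmonic invr_gt0.
  by exists d.
have [d' d'S Cd'] : reach ('d F z) C (inf S) (- F z).
  apply: (reach_cvg _ _ _ _ _ d (fun=> - F z) (fun n => inf S + harmonic n)) => //.
  - exact: diff_continuous.
  - by move=> n; exact: (hd n).1.
  - by move=> n; exact: (hd n).2.
  - exact: cvg_add_harmonic.
  - exact: cvg_cst.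
exists d'; split; first by move: Cd'; rewrite opprK addrC.
move=> e Ce; apply: le_trans d'S _; apply: ge_inf; first exact: S0.2.
by exists e => //=; rewrite opprK addrC.
Qed.

Lemma newton_directions_le z r d :
  reach ('d F z) C r (- F z) -> newton_directions F C z d -> `|d| <= r.
Proof.
move=> [e er]; rewrite opprK addrC => Ce [_ dmin].
exact: le_trans (dmin _ Ce) er.
Qed.

End cone_inclusion_reach.

(** * Newton's method for the scalar majorant *)

Lemma derive1_majorant (R : realType) (L b t : R) :
  derive1 (majorant L b) t = L * t - 1.
Proof.
have D := is_deriveB (is_deriveZ (L / 2) (is_deriveX 2 (is_derive_id t 1)))
  (is_derive_id t (1 : R)).
have E : majorant L b = ((L / 2) \*: (id ^+ 2) - id) + cst b :> (R -> R).
  apply/funext => z; transitivity (L / 2 * z ^+ 2 - z + b); last by rewrite !fctE.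
  by rewrite /majorant; ring.
rewrite derive1E E; have := is_deriveD D (is_derive_cst b t (1 : R)).
by move=> [_ ->]; rewrite /GRing.scale/=; field.
Qed.

Section scalar_newton_majorant.
Context {R : realType}.
Variables (L b : R).
Hypotheses (L0 : 0 < L) (b0 : 0 < b) (bL : 2 * b * L <= 1).

Let f := majorant L b.
Let ts := tstar L b.
Let t := scalar_newton f 0.
Let s := Num.sqrt (1 - 2 * b * L).

Let s_ge0 : 0 <= s. Proof. exact: sqrtr_ge0. Qed.

Let sE : s ^+ 2 = 1 - 2 * b * L.
Proof. by rewrite sqr_sqrtr// subr_ge0. Qed.

Let LtsE : L * ts = 1 - s.
Proof. by rewrite /ts /tstar -/s mulrC divfK// gt_eqF. Qed.

Lemma tstar_gt0 : 0 < ts.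
Proof.
have bL0 : 0 < b * L by exact: mulr_gt0.
have s1 : s < 1.
  by rewrite -(@ltr_pXn2r _ 2) ?nnegrE// sE expr1n; lra.
by rewrite -(pmulr_rgt0 _ L0) LtsE subr_gt0.
Qed.

Lemma Ltstar_le1 : L * ts <= 1. Proof. by rewrite LtsE gerBl. Qed.

(** Taylor expansion of the quadratic at its zero [ts], where the derivative is
    [L * ts - 1 = - s]. *)
Lemma majorant_tstar u : f u = (ts - u) * (s + L * (ts - u) / 2).
Proof.
have bE : b = (1 - s ^+ 2) / (2 * L) by rewrite sE; field; rewrite gt_eqF.
have -> : f u = L * u ^+ 2 / 2 - u + (1 - s ^+ 2) / (2 * L) by rewrite -bE.
have -> : s = 1 - L * ts by rewrite LtsE subKr.
by field; rewrite gt_eqF.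
Qed.

Lemma tstar_smallest u : f u = 0 -> ts <= u.
Proof.
rewrite majorant_tstar => /eqP; rewrite mulf_eq0 => /orP[/eqP ?|/eqP h]; first lra.
rewrite leNgt; apply/negP => uts.
have : 0 < L * (ts - u) by rewrite mulr_gt0// subr_gt0.
by have := s_ge0; lra.
Qed.

Let slope_gt0 u : u < ts -> s <= 1 - L * u /\ 0 < 1 - L * u.
Proof.
move=> uts; have : L * u < L * ts by rewrite ltr_pM2l.
by rewrite LtsE; have := s_ge0; lra.
Qed.

Lemma scalar_newtonS k : t k.+1 = t k + f (t k) / (1 - L * t k).
Proof.
rewrite /t /scalar_newton iterS derive1_majorant -/f.
by rewrite -[L * _ - 1]opprB invrN mulrN opprK.
Qed.

Lemma scalar_newton1 : t 1%N = b.
Proof.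
rewrite scalar_newtonS (_ : t 0%N = 0)// mulr0 subr0 divr1 add0r /f /majorant.
by rewrite expr0n/= mulr0 mul0r subr0 add0r.
Qed.

(** For a quadratic the Newton error is exactly the second-order remainder divided by the slope. *)
Lemma tstar_sub_newton k : t k < ts ->
  ts - t k.+1 = L / 2 * (ts - t k) ^+ 2 / (1 - L * t k).
Proof.
move=> /slope_gt0[_ D0]; rewrite scalar_newtonS majorant_tstar.
have -> : s = 1 - L * ts by rewrite LtsE subKr.
by field; rewrite gt_eqF.
Qed.

Lemma scalar_newton_itv k : 0 <= t k < ts.
Proof.
elim: k => [|k /andP[tk0 tkts]]; first by rewrite lexx tstar_gt0.
have [_ D0] := slope_gt0 _ tkts.
have u0 : 0 < ts - t k by lra.
apply/andP; split.
  rewrite scalar_newtonS addr_ge0// divr_ge0// ?ltW// majorant_tstar.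
  rewrite mulr_gt0// ltr_wpDl// divr_gt0// mulr_gt0//.
rewrite -subr_gt0 tstar_sub_newton// divr_gt0// mulr_gt0// ?exprn_gt0//.
by rewrite divr_gt0.
Qed.

Let t_lt k : t k < ts. Proof. by case/andP : (scalar_newton_itv k). Qed.

Lemma scalar_newton_incr k : t k < t k.+1.
Proof.
have [_ D0] := slope_gt0 _ (t_lt k).
have u0 : 0 < ts - t k by rewrite subr_gt0.
rewrite scalar_newtonS ltrDl divr_gt0// majorant_tstar.
by rewrite mulr_gt0// ltr_wpDl// divr_gt0// mulr_gt0.
Qed.

(** The error identity carries the factor [L * (ts - t k) / (1 - L * t k)], at most 1 because
    [L * ts <= 1]. *)
Lemma scalar_newton_half k : ts - t k.+1 <= 2^-1 * (ts - t k).
Proof.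
have [_ D0] := slope_gt0 _ (t_lt k).
rewrite tstar_sub_newton// ler_pdivrMr//.
have : L * (ts - t k) <= 1 - L * t k by have := Ltstar_le1; lra.
have u0 : 0 < ts - t k by rewrite subr_gt0.
by move=> /(ler_wpM2l (ltW u0)); lra.
Qed.

(** A Newton step cancels the linear part of [f], so [f (t k.+1)] is [L / 2] times the squared
    step. *)
Lemma scalar_newton_incrE k :
  t k.+2 - t k.+1 = L / 2 / (1 - L * t k.+1) * (t k.+1 - t k) ^+ 2.
Proof.
have [_ D0] := slope_gt0 _ (t_lt k); have [_ D1] := slope_gt0 _ (t_lt k.+1).
have dE : (t k.+1 - t k) * (1 - L * t k) = f (t k).
  by rewrite scalar_newtonS addrC addKr divfK// gt_eqF.
have -> : t k.+2 - t k.+1 = f (t k.+1) / (1 - L * t k.+1).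
  by rewrite scalar_newtonS addrC addKr.
rewrite mulrAC; congr (_ / _).
have : f (t k.+1) - f (t k) =
    (t k.+1 - t k) * (L * t k - 1) + L / 2 * (t k.+1 - t k) ^+ 2.
  by rewrite /f /majorant; field.
by rewrite -dE; lra.
Qed.

(** Division by 0 has a default value, so well-definedness of the scalar iteration needs this
    statement. *)
Lemma derive1_majorant_neq0 k : derive1 f (t k) != 0.
Proof.
have [_ D0] := slope_gt0 _ (t_lt k).
by rewrite derive1_majorant lt_eqF//; lra.
Qed.

Lemma scalar_newton_geometric k : ts - t k <= 2^-1 ^+ k * ts.
Proof.
elim: k => [|k ih]; first by rewrite expr0 mul1r subr0.
apply: le_trans (scalar_newton_half k) _.
by rewrite exprS -mulrA ler_pM2l.
Qed.

Lemma scalar_newton_cvg : t @ \oo --> ts.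
Proof.
suff : (fun k => ts - t k) @ \oo --> 0.
  move=> h; have -> : t = fun k => ts - (ts - t k) by apply/funext => k; rewrite subKr.
  by rewrite -[X in _ --> X]subr0; apply: cvgB => //; exact: cvg_cst.
apply: (@squeeze_cvgr _ _ _ _ (fun=> 0) (fun k => 2^-1 ^+ k * ts)).
- by near=> k; rewrite subr_ge0 ltW//= scalar_newton_geometric.
- exact: cvg_cst.
- rewrite -[X in _ --> X](mul0r ts); apply: cvgMl; apply: cvg_expr.
  by rewrite ger0_norm; lra.
Unshelve. all: by end_near. Qed.

Let K := L / (2 * s).

Lemma slope_inv_le k : 2 * b * L < 1 -> L / 2 / (1 - L * t k) <= K.
Proof.
move=> bL1; have s0 : 0 < s by rewrite sqrtr_gt0; lra.
have [sD D0] := slope_gt0 _ (t_lt k).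
rewrite /K invfM mulrA ler_pM2l ?divr_gt0//.
by rewrite lef_pV2 ?posrE.
Qed.

End scalar_newton_majorant.

(** * Quadratic convergence from quadratic bounds on the steps *)

Lemma limn_esup_le (R : realType) (u : nat -> \bar R) (c : R) :
  (forall e : R, 0 < e -> \forall k \near \oo, (u k <= (c + e)%:E)%E) ->
  (limn_esup u <= c%:E)%E.
Proof.
move=> uc; apply/lee_addgt0Pr => e e0.
rewrite /limn_esup /limf_esup -EFinD.
pose A := [set k | (u k <= (c + e)%:E)%E]; have oA : \oo A := uc e e0.
apply: (@le_trans _ _ (ereal_sup (u @` A))).
  by apply: ereal_inf_lbound; exists A.
by apply: ge_ereal_sup => _ [k Ak <-].
Qed.

Section quadratic_steps.
Context {R : realType} {V : normedModType R}.
Variables (x : nat -> V) (l : V) (K : R).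
Hypotheses (K0 : 0 < K) (xl : x @ \oo --> l).
Hypothesis (xK : forall k, `|x k.+2 - x k.+1| <= K * `|x k.+1 - x k| ^+ 2).

(* Once [K |x (k+1) - x k| <= eta] the steps decrease at least geometrically with
   ratio [eta], so each error is at most its first step divided by [1 - eta]. *)
Lemma quadratic_error (eta : R) : 0 < eta -> eta <= 8^-1 ->
  \forall k \near \oo,
    `|x k.+1 - l| <= K * (1 + 16 * eta) * `|x k - l| ^+ 2.
Proof.
move=> eta0 eta8.
pose delta k := `|x k.+1 - x k|.
have delta0 : \forall k \near \oo, forall j, (k <= j)%N -> K * delta j <= eta.
  have : (fun k => x k.+1 - x k) @ \oo --> (0 : V).
    by rewrite -(subrr l); apply: cvgB => //; rewrite cvg_shiftS.
  move=> /cvgr0Pnorm_le/(_ (eta / K)) /(_ ltac:(exact: divr_gt0)) [N _ hN].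
  near=> k => j kj; rewrite mulrC -ler_pdivlMr//; apply: hN => /=.
  apply: leq_trans kj; near: k; exact: nbhs_infty_ge.
have q0 : 0 < 1 - eta by lra.
near=> k.
have dk : forall j, (k <= j)%N -> K * delta j <= eta by near: k.
have dS j : (k <= j)%N -> delta j.+1 <= eta * delta j.
  move=> kj; apply: le_trans (xK j) _; rewrite expr2 mulrA.
  by rewrite ler_wpM2r//; exact: dk.
have far n j : (k <= j)%N -> `|x (j + n)%N - x j| <= delta j / (1 - eta).
  elim: n j => [|n ih] j kj.
    by rewrite addn0 subrr normr0 divr_ge0 ?normr_ge0 ?(ltW q0).
  have := ih j.+1 (leqW kj); rewrite addSnnS => h.
  have -> : x (j + n.+1)%N - x j = (x (j + n.+1)%N - x j.+1) + (x j.+1 - x j).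
    by rewrite addrA subrK.
  apply: le_trans (ler_normD _ _) _; apply: le_trans (lerD h (lexx _)) _.
  rewrite -/(delta j) -lerBrDr; apply: (@le_trans _ _ (eta * delta j / (1 - eta))).
    by rewrite ler_pM2r ?invr_gt0//; exact: dS.
  by rewrite le_eqVlt; apply/orP; left; apply/eqP; field; rewrite gt_eqF.
have err j : (k <= j)%N -> `|x j - l| <= delta j / (1 - eta).
  move=> kj; have : (fun n => `|x j - x (n + j)%N|) @ \oo --> `|x j - l|.
    by apply: cvg_norm; apply: cvgB; [exact: cvg_cst|rewrite cvg_shiftn].
  move=> h; apply: (@closed_cvg _ _ \oo _ _ [set y | y <= _] _ _ _ h).
    exact: closed_le.
  by apply: nearW => n /=; rewrite distrC addnC; exact: far.
have e1 := err k.+1 (leqnSn k).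
have d1 := dS k (leqnn k).
have dE : delta k <= `|x k - l| + `|x k.+1 - l|.
  rewrite [X in _ <= X + _]distrC addrC; apply: le_trans (ler_normD _ _).
  by rewrite addrA subrK.
(* The error at [k.+1] is at most [eta / (1 - eta)] times the step, so the step is controlled by the
   error at [k] alone. *)
have d2 : delta k * (1 - 2 * eta) <= (1 - eta) * `|x k - l|.
  have : `|x k.+1 - l| * (1 - eta) <= eta * delta k.
    by rewrite -ler_pdivlMr//; apply: le_trans e1 _; rewrite ler_pM2r ?invr_gt0.
  have := ler_wpM2r (ltW q0) dE; lra.
have k2 := xK k; rewrite -/(delta _) -/(delta _) in k2.
have p0 : 0 < 1 - 2 * eta by lra.
have d3 : delta k ^+ 2 * (1 - 2 * eta) ^+ 2 <= (1 - eta) ^+ 2 * `|x k - l| ^+ 2.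
  rewrite -!exprMn; apply: lerXn2r => //; rewrite nnegrE mulr_ge0 ?normr_ge0//.
    exact: ltW p0.
  exact: ltW q0.
have e2 : `|x k.+1 - l| * (1 - eta) <= K * delta k ^+ 2.
  by rewrite -ler_pdivlMr//; apply: le_trans e1 _; rewrite ler_pM2r ?invr_gt0.
rewrite -(ler_pM2r q0) -(@ler_pM2r _ ((1 - 2 * eta) ^+ 2)) ?exprn_gt0//.
apply: (@le_trans _ _ (K * (delta k ^+ 2 * (1 - 2 * eta) ^+ 2))).
  by rewrite [leRHS]mulrA; apply: ler_wpM2r e2; rewrite exprn_ge0// ltW.
apply: (@le_trans _ _ (K * ((1 - eta) ^+ 2 * `|x k - l| ^+ 2))).
  by rewrite ler_pM2l.
have E2 : 0 <= K * `|x k - l| ^+ 2 by rewrite mulr_ge0// ltW.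
(* The bounds above give the factor [(1 - eta) / (1 - 2 * eta) ^+ 2]; for [eta] at most 1/8 it is at
   most [1 + 16 * eta]. *)
have h1 : 0 <= (1 + 16 * eta) * (1 - 2 * eta) ^+ 2 - (1 - eta).
  have : 0 <= eta * eta by rewrite mulr_ge0// ltW.
  have : eta * eta <= eta * 8^-1 by rewrite ler_pM2l.
  have : 0 <= eta * eta * eta by rewrite !mulr_ge0// ltW.
  by rewrite !expr2; nra.
have h2 := mulr_ge0 (mulr_ge0 (ltW q0) h1) E2.
by rewrite -subr_ge0; apply: le_trans h2 _; rewrite le_eqVlt; apply/orP; left; apply/eqP; ring.
Unshelve. all: by end_near. Qed.

Lemma quadratic_limn_esup :
  (limn_esup (fun k => (`|l - x k.+1| / `|l - x k| ^+ 2)%R%:E) <= K%:E)%E.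
Proof.
apply: limn_esup_le => e e0.
pose eta := Num.min 8^-1 (e / (16 * K)).
have eta0 : 0 < eta by rewrite lt_min invr_gt0 ltr0n/= divr_gt0// mulr_gt0.
have := quadratic_error eta eta0; rewrite ge_min lexx => /(_ isT).
apply: filterS => k hk; rewrite lee_fin ![`|l - _|]distrC.
(* A zero error makes the quotient 0 by the convention for division. *)
have [->|xk] := eqVneq (`|x k - l|) 0.
  by rewrite expr0n/= invr0 mulr0 addr_ge0// ltW.
rewrite ler_pdivrMr ?exprn_gt0// ?lt_neqAle 1?eq_sym ?xk ?normr_ge0//.
apply: le_trans hk _; rewrite ler_wpM2r ?exprn_ge0//.
have : eta * (16 * K) <= e.
  by rewrite -ler_pdivlMr ?mulr_gt0// /eta ge_min lexx orbT.
by rewrite mulrDr mulr1 lerD2l; lra.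
Qed.

Lemma quadratic_Q_quadratic : Q_quadratic x l.
Proof.
split => //; exists (K * (1 + 16 * 8^-1)); exact: quadratic_error.
Qed.

End quadratic_steps.

(** * Newton's method for the cone inclusion *)

Section newton_cone_inclusion.
Context {R : realType} {X Y : completeNormedModType R}.
Variables (F : X -> Y) (C : set Y) (xt : X) (L b : R).
Hypotheses (rX : reflexive_space X).
Hypotheses (C0 : C !=set0) (cC : closed C) (vC : convex_set C) (kC : cone C).
Hypotheses (L0 : 0 < L) (b0 : 0 < b) (bL : 2 * b * L <= 1).

Let ts := tstar L b.
Let t := scalar_newton (majorant L b) 0.

Hypothesis dF : forall z, `|z - xt| <= ts -> differentiable F z.
Hypothesis rob : robinson F C xt.
Hypothesis lipF : forall x y, `|x - xt| < ts -> `|y - xt| < ts ->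
  (sv_norm (fun d => Tinv F C xt ('d F y d - 'd F x d)%R)
     <= (L * `|y - x|)%R%:E)%E.
Hypothesis init : (set_norm (Tinv F C xt (- F xt)%R) <= b%:E)%E.

Let A := 'd F xt.

Let ts0 : 0 < ts. Proof. exact: tstar_gt0. Qed.

Let dFxt : differentiable F xt.
Proof. by apply: dF; rewrite subrr normr0 ltW. Qed.

Let cA : continuous A. Proof. exact: diff_continuous. Qed.

Let lip_reach x y d : `|x - xt| < ts -> `|y - xt| < ts ->
  reach A C (L * `|y - x| * `|d|) ('d F y d - 'd F x d).
Proof.
move=> xts yts.
exact: (@sv_norm_reach _ _ _ F C rX C0 cC vC kC xt ('d F y \- 'd F x))
  dFxt rob (lipF x y xts yts).
Qed.

(** [reach_perturbation] with ratio [L * |z - xt|], which is below 1 because [L * ts <= 1]. *)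
Lemma reach_near z rho w : `|z - xt| < ts -> reach A C rho w ->
  reach ('d F z) C (rho / (1 - L * `|z - xt|)) w.
Proof.
move=> zts; apply: reach_perturbation => //.
- by apply: diff_continuous; apply: dF; exact: ltW.
- rewrite mulr_ge0 ?(ltW L0)//=.
  have := Ltstar_le1 L b L0; rewrite -/ts; apply: lt_le_trans.
  by rewrite ltr_pM2l.
- by move=> d; apply: lip_reach => //; rewrite subrr normr0.
Qed.

(** [F z'] is the linearization at [z], which lies in [C], plus the linearization error. Adding the
    two memberships in [C] bounds the solution for [- F z'] by that for the error. *)
Lemma reach_newton_step z z' : `|z - xt| < ts -> `|z' - xt| < ts ->
  newton_step F C z z' ->
  reach A C (L * `|z' - z| ^+ 2 / 2) (- F z').
Proof.
move=> zts + [d [Cd _] zz']; rewrite -{z'}zz' => z'ts.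
rewrite addrAC subrr add0r.
have seg (u : R) : 0 <= u <= 1 -> `|z + u *: d - xt| < ts.
  move=> /andP[u0 u1].
  have -> : z + u *: d - xt = (1 - u) *: (z - xt) + u *: (z + d - xt).
    rewrite [z + d - xt]addrAC [u *: (_ + d)]scalerDr [RHS]addrA -scalerDl.
    by rewrite subrK scale1r [LHS]addrAC.
  apply: le_lt_trans (ler_normD _ _) _; rewrite !normrZ !ger0_norm ?subr_ge0//.
  have [->|un0] := eqVneq u 0; first by rewrite subr0 mul1r mul0r addr0.
  have up : 0 < u by rewrite lt_neqAle eq_sym un0.
  have : u * `|z + d - xt| < u * ts by rewrite ltr_pM2l.
  have : (1 - u) * `|z - xt| <= (1 - u) * ts by rewrite ler_wpM2l ?subr_ge0// ltW.
  lra.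
have [e er Ce] : reach A C (L * `|d| ^+ 2 / 2) ('d F z d - (F (z + d) - F z)).
  apply: linearization_error_reach => //.
  - by rewrite mulr_ge0 ?exprn_ge0// ltW.
  - by move=> u u01; apply: dF; rewrite ltW// seg.
  - move=> u /andP[u0 u1].
    (* Taken at [- d], since [reach] is not symmetric and the error needs the difference of
       derivatives in this orientation. *)
    have := lip_reach z (z + u *: d) (- d) zts (seg u _).
    rewrite !ltW//= => /(_ isT); rewrite addrAC subrr add0r normrZ normrN gtr0_norm//.
    rewrite !linearN/= opprK addrC expr2.
    by apply: reach_ler; rewrite le_eqVlt; apply/orP; left; apply/eqP; ring.
exists e => //.
have := convex_cone_add _ _ _ _ _ vC kC Ce Cd.
have cancel (p q v w : Y) : p - (q - (v - w)) + (w + q) = p + v.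
  by rewrite opprB [p + (v - w - q)]addrA [w + q]addrC [LHS]addrA subrK -addrA subrK.
by have := cancel (A e) ('d F z d) (F (z + d)) (F z) => E; rewrite opprK -E.
Qed.

(** Stated for a finite run, so that it can serve to prove that a further step exists. The bounds
    are proved jointly: each new step bound relies on the previous distance to [xt]. *)
Lemma newton_step_le n (x : nat -> X) : x 0%N = xt ->
  (forall k, (k < n)%N -> newton_step F C (x k) (x k.+1)) ->
  (forall k, (k <= n)%N -> `|x k - xt| <= t k) /\
  (forall k, (k < n)%N -> `|x k.+1 - x k| <= t k.+1 - t k) /\
  (forall k, (k.+1 < n)%N -> `|x k.+2 - x k.+1| <=
      L / 2 / (1 - L * t k.+1) * `|x k.+1 - x k| ^+ 2).
Proof.
move=> x0; elim: n => [_|n ih hx].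
  split; last by [].
  by move=> k; rewrite leqn0 => /eqP ->; rewrite x0 subrr normr0.
have [xt_le [dx_le dx2_le]] := ih (fun k kn => hx k (ltnW kn)).
have in_ball k : (k <= n)%N -> `|x k - xt| < ts.
  move=> kn; apply: le_lt_trans (xt_le k kn) _.
  by case/andP : (scalar_newton_itv L b L0 b0 bL k).
have [d dir dE] := hx n (ltnSn n).
have dE' : x n.+1 - x n = d by rewrite -dE addrAC subrr add0r.
have quad m : n = m.+1 -> `|x n.+1 - x n| <=
    L / 2 / (1 - L * t n) * `|x n - x m| ^+ 2.
  move=> nm; have mn : (m < n)%N by rewrite nm.
  have xm := in_ball m (ltnW mn); have xn := in_ball n (leqnn n).
  have := hx m (leqW mn); rewrite -nm => stp.
  have := reach_near _ _ _ xn (reach_newton_step _ _ xm xn stp).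
  move=> /newton_directions_le/(_ dir); rewrite dE'; move/le_trans; apply.
  have tn : L * t n < 1.
    apply: lt_le_trans (Ltstar_le1 L b L0); rewrite ltr_pM2l//.
    by case/andP : (scalar_newton_itv L b L0 b0 bL n).
  have Lx : L * `|x n - xt| <= L * t n by rewrite ler_pM2l// xt_le.
  rewrite [L * _ / 2]mulrAC [leRHS]mulrAC.
  apply: ler_wpM2l; first by rewrite mulr_ge0 ?exprn_ge0 ?divr_ge0 ?(ltW L0).
  by rewrite lef_pV2 ?posrE; lra.
(* The first step is at most [b], which is [t 1]; later ones compare the quadratic bound with the
   exact recursion [scalar_newton_incrE]. *)
have lin : `|x n.+1 - x n| <= t n.+1 - t n.
  move: quad; case: (n) xt_le dx_le dir dE' => [|m] xt_le dx_le dir dE' quad.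
    rewrite /t (scalar_newton1 L b) subr0 dE'.
    apply: (newton_directions_le _ _ _ _ _ _ dir); rewrite x0.
    exact: set_norm_reach.
  apply: le_trans (quad m erefl) _.
  rewrite /t (scalar_newton_incrE L b L0 b0 bL) -/t ler_wpM2l//.
    have tn : L * t m.+1 < 1.
      apply: lt_le_trans (Ltstar_le1 L b L0); rewrite ltr_pM2l//.
      by case/andP : (scalar_newton_itv L b L0 b0 bL m.+1).
    by rewrite divr_ge0// ?divr_ge0 ?(ltW L0)//; lra.
  by rewrite lerXn2r ?nnegrE// ?dx_le// subr_ge0 ltW// scalar_newton_incr.
split; last split.
- move=> k; rewrite leq_eqVlt => /orP[/eqP ->|]; last exact: xt_le.
  have -> : x n.+1 - xt = (x n.+1 - x n) + (x n - xt) by rewrite addrA subrK.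
  apply: le_trans (ler_normD _ _) _.
  by have := lerD lin (xt_le n (leqnn n)); rewrite subrK.
- by move=> k; rewrite ltnS leq_eqVlt => /orP[/eqP ->|] //; exact: dx_le.
- move=> k; rewrite ltnS leq_eqVlt => /orP[/eqP kn|]; last exact: dx2_le.
  by rewrite kn; exact: quad.
Qed.

(** Robinson's condition solves the inclusion for [- F z] with the derivative at [xt]; [reach_near]
    transfers solvability to [z]. *)
Lemma newton_directions_neq0 z : `|z - xt| < ts ->
  newton_directions F C z !=set0.
Proof.
move=> zts.
have [d0 _ [c Cc cE]] : sv_range (Tmap F C xt) (- F z) by rewrite rob.
have r0 : reach A C `|d0| (- F z) by exists d0 => //; rewrite -cE subKr.
have dFz : differentiable F z by apply: dF; exact: ltW.
exact: (newton_directions_exist _ _ rX cC vC _ _ dFz (reach_near _ _ _ zts r0)).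
Qed.

Lemma newton_sequence_in_ball (x : nat -> X) n : x 0%N = xt ->
  (forall k, (k < n)%N -> newton_step F C (x k) (x k.+1)) ->
  `|x n - xt| < ts.
Proof.
move=> x0 hx; apply: le_lt_trans ((newton_step_le _ _ x0 hx).1 n (leqnn n)) _.
by case/andP : (scalar_newton_itv L b L0 b0 bL n).
Qed.

Lemma newton_sequence_exists : exists x, newton_sequence F C xt x.
Proof.
(* The step function is made total by an arbitrary value outside the ball; strong induction shows
   that the iterates never leave it. *)
have /choice[g hg] (z : X) : exists z', `|z - xt| < ts -> newton_step F C z z'.
  have [zts|] := boolP (`|z - xt| < ts); last by exists z.
  by have [d dir] := newton_directions_neq0 _ zts; exists (z + d) => _; exists d.
exists (fun k => iter k g xt); split => // k.
elim/ltn_ind: k => k ih; apply: hg.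
exact: (newton_sequence_in_ball (fun k => iter k g xt)).
Qed.

(** Telescoping against [t] makes the iterates Cauchy. [- F (x k.+1)] is reached within a radius
    tending to 0, so the limit is reached by the zero direction, which means that [F xs] lies in
    [C]. *)
Lemma newton_sequence_cvg (x : nat -> X) : newton_sequence F C xt x ->
  exists xs, [/\ `|xs - xt| <= ts, C (F xs), x @ \oo --> xs &
    forall k, `|xs - x k| <= ts - t k].
Proof.
move=> [x0 hx].
have dx k : `|x k.+1 - x k| <= t k.+1 - t k.
  exact: (newton_step_le k.+1 _ x0 (fun j _ => hx j)).2.1.
have in_ball k : `|x k - xt| < ts by exact: (newton_sequence_in_ball _ k x0 (fun j _ => hx j)).
have t_lt k : t k < ts by case/andP : (scalar_newton_itv L b L0 b0 bL k).
have far n k : `|x (k + n)%N - x k| <= t (k + n)%N - t k.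
  elim: n => [|n ih]; first by rewrite addn0 !subrr normr0.
  have -> : x (k + n.+1)%N - x k = (x (k + n).+1 - x (k + n)%N) + (x (k + n)%N - x k).
    by rewrite addnS addrA subrK.
  apply: le_trans (ler_normD _ _) _; apply: le_trans (lerD (dx _) ih) _.
  by rewrite addrA subrK addnS.
have far_ts n k : (k <= n)%N -> `|x n - x k| <= ts - t k.
  move=> kn; rewrite -(subnKC kn); apply: le_trans (far _ _) _.
  by rewrite lerD2r ltW.
have /cvg_ex[xs xxs] : cvg (x @ \oo).
  apply/cauchy_cvgP/cauchy_exP => e e0.
  have := scalar_newton_cvg L b L0 b0 bL => /cvgrPdist_lt/(_ e e0)[N _ /(_ N (leqnn N))].
  rewrite -/t -/ts ger0_norm ?subr_ge0 ?(ltW (t_lt _))// => tN.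
  exists (x N); exists N => // n /= Nn.
  rewrite -ball_normE /= distrC; apply: le_lt_trans tN.
  exact: far_ts.
have xs_le k : `|xs - x k| <= ts - t k.
  have h : (fun n => `|x n - x k|) @ \oo --> `|xs - x k|.
    by apply: cvg_norm; apply: cvgB => //; exact: cvg_cst.
  apply: (@closed_cvg _ _ \oo _ _ [set y | y <= _] _ _ _ h); first exact: closed_le.
  by exists k => // n /= kn; exact: far_ts.
have xs_ball : `|xs - xt| <= ts by have := xs_le 0; rewrite x0 subr0.
exists xs; split => //.
have /choice[d hd] k : exists d, `|d| <= L * (t k.+1 - t k) ^+ 2 / 2 /\ C (A d - - F (x k.+1)).
  have [d dr Cd] := reach_newton_step _ _ (in_ball k) (in_ball k.+1) (hx k).
  exists d; split=> //; apply: le_trans dr _.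
  rewrite ler_pM2r ?invr_gt0// ler_pM2l// lerXn2r ?nnegrE//.
  by rewrite subr_ge0 ltW// scalar_newton_incr.
have tt : t @ \oo --> ts by exact: scalar_newton_cvg.
have tS : (fun k => t k.+1) @ \oo --> ts by rewrite (cvg_shiftS t).
have xS : (fun k => x k.+1) @ \oo --> xs by rewrite (cvg_shiftS x).
have [] : reach A C 0 (- F xs).
  apply: (reach_cvg _ _ _ A C d (fun k => - F (x k.+1))
    (fun k => L * (t k.+1 - t k) ^+ 2 / 2)) => //.
  - by move=> k; exact: (hd k).1.
  - by move=> k; exact: (hd k).2.
  - have : (fun k => L * ((t k.+1 - t k) * (t k.+1 - t k)) / 2) @ \oo -->
        L * ((ts - ts) * (ts - ts)) / 2.
      by apply: cvgMl; apply: cvgMr; apply: cvgM; exact: cvgB.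
    by rewrite subrr mul0r mulr0 mul0r; under eq_fun do rewrite -expr2.
  (* The limit may lie on the boundary sphere; [dF] covers the closed ball and gives continuity of
     [F] there. *)
  - apply: cvgN; apply: (cvg_comp _ _ xS).
    exact: differentiable_continuous (dF _ xs_ball).
move=> e; rewrite normr_le0 => /eqP ->.
by rewrite linear0 sub0r opprK.
Qed.

End newton_cone_inclusion.

Theorem theorem18 (R : realType) (X Y : completeNormedModType R)
    (hX : reflexive_space X)
    (Om : set X) (hOm : open Om)
    (F : X -> Y) (hF : continuously_differentiable_on Om F)
    (C : set Y) (hC0 : C !=set0) (hCclosed : closed C)
    (hCconvex : convex_set C) (hCcone : cone C)
    (xt : X) (hxt : Om xt)
    (r L b : R) (hr : 0 < r) (hL : 0 < L) (hb : 0 < b)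
    (hRob : robinson F C xt)
    (hball : ball xt r `<=` Om)
    (hLip : forall x y : X, ball xt r x -> ball xt r y ->
       (sv_norm (fun d => Tinv F C xt ('d F y d - 'd F x d)%R)
          <= (L * `|y - x|)%R%:E)%E)
    (hbL : 2 * b * L <= 1)
    (hinit : (set_norm (Tinv F C xt (- F xt)%R) <= b%:E)%E)
    (htr : tstar L b <= r)
    (htOm : closed_ball_ Num.norm xt (tstar L b) `<=` Om) :
  let f := majorant L b in
  let ts := tstar L b in
  let t := scalar_newton f 0 in
  let K := L / (2 * Num.sqrt (1 - 2 * b * L)) in
  (* smallest zero of f on [0, +oo[ *)
  [/\ 0 <= ts, f ts = 0 & forall s, 0 <= s -> f s = 0 -> ts <= s] /\
  (* Newton's method for f(t) = 0 *)
  [/\ (forall k, derive1 f (t k) != 0),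
      (forall k, t k < t k.+1),
      (forall k, 0 <= t k < ts),
      t @ \oo --> ts &
      (forall k, ts - t k.+1 <= 2^-1 * (ts - t k))] /\
  Q_linear t ts /\
  (2 * b * L < 1 ->
     [/\ (forall k, t k.+2 - t k.+1 <= K * (t k.+1 - t k) ^+ 2),
         (forall k, ts - t k.+1 <= K * (ts - t k) ^+ 2) &
         Q_quadratic t ts]) /\
  (* Newton's method for F(x) \in C: whatever the previous choices, the method
     stays in Om and a further step is possible *)
  (forall (n : nat) (x : nat -> X), x 0%N = xt ->
     (forall k, (k < n)%N -> newton_step F C (x k) (x k.+1)) ->
     Om (x n) /\ newton_directions F C (x n) !=set0) /\
  (exists x : nat -> X, newton_sequence F C xt x) /\
  (forall x : nat -> X, newton_sequence F C xt x ->
     (forall k, ball xt ts (x k)) /\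
     (forall k, `|x k.+1 - x k| <= t k.+1 - t k) /\
     (forall k, `|x k.+2 - x k.+1| <=
        (t k.+2 - t k.+1) / (t k.+1 - t k) ^+ 2 * `|x k.+1 - x k| ^+ 2) /\
     (exists xs : X,
        [/\ closed_ball_ Num.norm xt ts xs, C (F xs), x @ \oo --> xs,
            (forall k, `|xs - x k| <= ts - t k) & R_linear x xs] /\
        (2 * b * L < 1 ->
           [/\ (forall k, `|x k.+2 - x k.+1| <= K * `|x k.+1 - x k| ^+ 2),
               Q_quadratic x xs &
               (limn_esup (fun k =>
                  (`|xs - x k.+1| / `|xs - x k| ^+ 2)%R%:E) <= K%:E)%E]))).
Proof.
move=> f ts t K.
have ts0 : 0 < ts by exact: tstar_gt0.
have t_itv k : 0 <= t k < ts := scalar_newton_itv L b hL hb hbL k.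
have t_lt k : t k < ts by case/andP : (t_itv k).
have t_incr k : t k < t k.+1 := scalar_newton_incr L b hL hb hbL k.
have t_half k : ts - t k.+1 <= 2^-1 * (ts - t k) := scalar_newton_half L b hL hb hbL k.
have t_cvg : t @ \oo --> ts := scalar_newton_cvg L b hL hb hbL.
have t_incrE k : t k.+2 - t k.+1 = L / 2 / (1 - L * t k.+1) * (t k.+1 - t k) ^+ 2.
  exact: scalar_newton_incrE.
have slope_le k : 2 * b * L < 1 -> L / 2 / (1 - L * t k) <= K.
  exact: slope_inv_le.
have t_quad k : 2 * b * L < 1 -> ts - t k.+1 <= K * (ts - t k) ^+ 2.
  move=> bL1; rewrite (tstar_sub_newton L b hL hbL)// mulrAC.
  by rewrite ler_wpM2r ?exprn_ge0 ?subr_ge0 ?(ltW (t_lt k))//; exact: slope_le.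
have ballts z : (ball xt ts z) = (`|z - xt| < ts) :> Prop by rewrite -ball_normE /= distrC.
(* The explicit assumptions on the radius enter here: [htr] puts the open ball of radius [ts] inside
   the Lipschitz region, and [htOm] gives differentiability up to its boundary. *)
have ts_r z : `|z - xt| < ts -> ball xt r z.
  by move=> zts; rewrite -ball_normE /= distrC; exact: lt_le_trans htr.
have dF z : `|z - xt| <= ts -> differentiable F z.
  by move=> zts; apply: hF.1; apply: htOm; rewrite /closed_ball_ /= distrC.
have lipF x y : `|x - xt| < ts -> `|y - xt| < ts ->
    (sv_norm (fun d => Tinv F C xt ('d F y d - 'd F x d)%R)
       <= (L * `|y - x|)%R%:E)%E.
  by move=> xts yts; apply: hLip; exact: ts_r.
have errE k : `|ts - t k| = ts - t k by rewrite ger0_norm// subr_ge0 ltW.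
split; first split.
- exact: ltW.
- by rewrite /f majorant_tstar// subrr mul0r.
- by move=> s _; exact: tstar_smallest.
split; first split => //.
  by move=> k; exact: derive1_majorant_neq0.
have t_linear : Q_linear t ts.
  split => //; exists 2^-1; split; [lra|lra|].
  by apply: nearW => k; rewrite ![`|t _ - _|]distrC !errE.
split => //; split.
  move=> bL1; split => [k|k|]; last split => //.
  - rewrite t_incrE ler_wpM2r ?exprn_ge0 ?subr_ge0 ?(ltW (t_incr k))//.
    exact: slope_le.
  - exact: t_quad.
  - exists K; apply: nearW => k; rewrite ![`|t _ - _|]distrC !errE.
    exact: t_quad.
split.
  move=> n x x0 hx.
  have xn := newton_sequence_in_ball F C xt L b hX hC0 hCclosed hCconvex hCcone
    hL hb hbL dF hRob lipF hinit x n x0 hx.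
  split; first by apply: hball; exact: ts_r.
  exact: (newton_directions_neq0 F C xt L b hX hC0 hCclosed hCconvex hCcone
    hL hb hbL dF hRob lipF).
split.
  exact: (newton_sequence_exists F C xt L b).
move=> x hx; have [x0 stp] := hx.
have [xs [xs_ball Cxs xxs xs_le]] := newton_sequence_cvg F C xt L b hX hC0 hCclosed
  hCconvex hCcone hL hb hbL dF hRob lipF hinit x hx.
have bounds n := newton_step_le F C xt L b hX hC0 hCclosed hCconvex hCcone
  hL hb hbL dF hRob lipF hinit n x x0 (fun k _ => stp k).
have dx k : `|x k.+1 - x k| <= t k.+1 - t k := (bounds k.+1).2.1 k (ltnSn k).
have dx2 k : `|x k.+2 - x k.+1| <= L / 2 / (1 - L * t k.+1) * `|x k.+1 - x k| ^+ 2.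
  exact: (bounds k.+2).2.2 k (ltnSn _).
split=> [k|].
  rewrite ballts; apply: le_lt_trans ((bounds k).1 k (leqnn k)) _.
  exact: t_lt.
split => //; split=> [k|].
  (* By the exact scalar recursion the quotient equals [L / 2 / (1 - L * t k.+1)], the factor in
     [dx2]. *)
  rewrite t_incrE mulfK ?expf_neq0 ?gt_eqF ?subr_gt0//.
have x_quad k : 2 * b * L < 1 -> `|x k.+2 - x k.+1| <= K * `|x k.+1 - x k| ^+ 2.
  by move=> bL1; apply: le_trans (dx2 k) _; rewrite ler_wpM2r ?exprn_ge0//; exact: slope_le.
exists xs; split.
  split => //.
    by rewrite /closed_ball_ /= distrC.
  exists (fun k => ts - t k); split.
    split; first by rewrite -(subrr ts); apply: cvgB => //; exact: cvg_cst.
    exists 2^-1; split; [lra|lra|].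
    by apply: nearW => k; rewrite !subr0 !errE.
  by move=> k; rewrite distrC.
move=> bL1; have K0 : 0 < K.
  by rewrite divr_gt0// mulr_gt0// sqrtr_gt0 subr_gt0.
split=> [k||]; first exact: x_quad.
- by apply: (@quadratic_Q_quadratic _ _ x xs K) => // k; exact: x_quad.
- by apply: (@quadratic_limn_esup _ _ x xs K) => // k; exact: x_quad.
Qed.
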